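(* Employing the BR2 (Bassi and Rebay II) scheme for the one-dimensional diffusion equation $\partial_t u=b\,\Delta u$ with the ESFR (energy stable flux reconstruction) methods, as described in the context, with penalty parameter $s$, let $$s^*=\frac{2\,\min_{\kappa}\big(|\nabla_r g_L(1)|-\nabla_r g_L(-1)\big)}{(p+1)^2},$$ where the minimum is over the parameter $\kappa$ of the left ESFR correction function $g_L$. If $s$ is greater than $s^*$, then $$\sum_{e=1}^{N_e}\Theta_e\le 0,$$ which implies that the scheme is energy stable: $$\frac{d}{dt}\|U\|_{p,c}^2\le 0 .$$
   Context: Mesh: the domain $\Omega$ is partitioned into non-overlapping elements $\Omega_n=[x_n,x_{n+1}]$, $1\le n\le N_K$, with $h_n=x_{n+1}-x_n$ and $J_n=h_n/2$; $\Omega_n$ is the image of $r\in[-1,1]$ under $x=\frac{1-r}{2}x_n+\frac{1+r}{2}x_{n+1}$. On each $\Omega_n$, the numerical solution $u_n$ and the corrected gradient $q_n$ are polynomials of degree $p$ (i.e. at most $p$) in space, with $p\ge1$. Write $\nabla=\partial/\partial x$, $\nabla_r=\partial/\partial r$; $b>0$ is a constant. Correction functions: $\Psi_m$ is the Legendre polynomial of degree $m$ (with $\Psi_m(1)=1$), $a_p=\frac{(2p)!}{2^p(p!)^2}$, $\eta_{p,\kappa}=\frac{\kappa(2p+1)(a_pp!)^2}{2}$. The ESFR correction functions with scalar parameter $\kappa$ are $$g_L=\frac{(-1)^p}{2}\left[\Psi_p-\frac{\eta_{p,\kappa}\Psi_{p-1}+\Psi_{p+1}}{1+\eta_{p,\kappa}}\right],\quad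 g_R=\frac12\left[\Psi_p+\frac{\eta_{p,\kappa}\Psi_{p-1}+\Psi_{p+1}}{1+\eta_{p,\kappa}}\right],$$ and $h_L,h_R$ are given by the same formulas with a scalar parameter $c$ in place of $\kappa$. The parameters $\kappa$ and $c$ range over $]c_-,\infty[$, where $c_-=-\frac{2}{(2p+1)(a_pp!)^2}$ (equivalently $1+\eta_{p,\kappa}>0$ and $1+\eta_{p,c}>0$). Scheme: on every element, $$\frac{\partial u_n}{\partial t}=\frac{b}{J_n}\left[\nabla_r q_n+(q^*-q_n)|_{-1}\nabla_r h_L+(q^*-q_n)|_{1}\nabla_r h_R\right],$$ $$q_n=\frac1{J_n}\left[\nabla_r u_n+(u^*-u_n)|_{-1}\nabla_r g_L+(u^*-u_n)|_{1}\nabla_r g_R\right],$$ where $|_{-1}$ and $|_{1}$ denote evaluation at the left and right endpoints of $\Omega_n$. BR2 numerical fluxes: at an edge $e$ (interface between elements), let $v_{e,-}$, $v_{e,+}$ be the values of $v$ from the left and right side; $[\![v_e]\!]=v_{e,-}-v_{e,+}$, $\{\{v_e\}\}=\frac12(v_{e,-}+v_{e,+})$. Then $u^*=\{\{u\}\}$ and $q^*=\{\{\nabla u\}\}+s\{\{r^e([\![u]\!])\}\}$, where $\nabla u$ is the elementwise derivative of $u$ in $x$ and the lifting operator $r^e([\![u]\!])$ is the piecewise polynomial of degree $p$ on the mesh with $\int_\Omega r^e([\![u]\!])\phi\,dx=-[\![u_e]\!]\{\{\phi_e\}\}$ for all test functions $\phi$ (piecewise polynomials of degree at most $p$ on the mesh).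 Edge terms: $N_e$ is the number of edges and $$\Theta_e=(u_{e,+}q_{e,+}-u_{e,-}q_{e,-})-q^*_e(u_{e,+}-u_{e,-})-u^*_e(q_{e,+}-q_{e,-}).$$ Energy norm: $$\|U\|_{p,c}=\left\{\sum_{n=1}^{N_K}\int_{x_n}^{x_{n+1}}\left[u_n^2+\frac c2 J_n^{2p}\left(\frac{\partial^p u_n}{\partial x^p}\right)^2\right]dx\right\}^{1/2}.$$
   Formalization: The sum of Θ_e ≤ 0 is stated only for q_n built with a κ attaining the minimum in s* (it fails for other κ, e.g. p=1, κ=0, s=1); energy stability is for all κ, c. The mesh is taken periodic with N_K ≥ 2, as boundary fluxes are unspecified. *)

(* Defs.v *)
From HB Require Import structures.
From mathcomp Require Import all_boot all_order all_algebra.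
From mathcomp Require Import all_classical all_reals all_analysis.
Set Implicit Arguments.
Unset Strict Implicit.
Unset Printing Implicit Defensive.
Import Order.TTheory GRing.Theory Num.Theory.
Import numFieldNormedType.Exports.
Local Open Scope classical_set_scope.
Local Open Scope ring_scope.

(* Rodrigues' formula; the normalization gives the value 1 at 1. *)
Definition legendre (R : realType) (m : nat) : {poly R} :=
  ((2 ^ m * m`!)%N%:R)^-1 *: (('X^2 - 1) ^+ m)^`(m).

Definition acoef (R : realType) (p : nat) : R :=
  (2 * p)`!%:R / (2 ^ p * p`! ^ 2)%N%:R.

Definition eta (R : realType) (p : nat) (k : R) : R :=
  k * (2 * p + 1)%N%:R * (acoef R p * p`!%:R) ^+ 2 / 2.

Definition cminus (R : realType) (p : nat) : R :=
  - (2 / ((2 * p + 1)%N%:R * (acoef R p * p`!%:R) ^+ 2)).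

Definition corrL (R : realType) (p : nat) (k : R) : {poly R} :=
  ((-1) ^+ p / 2) *:
    (legendre R p
     - (1 + eta p k)^-1 *: (eta p k *: legendre R p.-1 + legendre R p.+1)).

Definition corrR (R : realType) (p : nat) (k : R) : {poly R} :=
  (1 / 2) *:
    (legendre R p
     + (1 + eta p k)^-1 *: (eta p k *: legendre R p.-1 + legendre R p.+1)).

Definition gL_gap (R : realType) (p : nat) (k : R) : R :=
  `|((corrL p k)^`()).[1]| - ((corrL p k)^`()).[-1].

Definition min_gL_gap (R : realType) (p : nat) : R :=
  inf [set gL_gap p k | k in [set k : R | cminus R p < k]].

Definition attains_min_gL_gap (R : realType) (p : nat) (k : R) : Prop :=
  cminus R p < k /\ gL_gap p k = min_gL_gap R p.

Definition s_star (R : realType) (p : nat) : R :=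
  2 * min_gL_gap R p / (p + 1)%N%:R ^+ 2.

(* Elements are numbered from 0: the element n < N is [x n, x n.+1].  The mesh
   is periodic, its end points x 0 and x N being the same interface: the edge
   e : 'I_N is the right end of the element e and the left end of the element
   ordS e, so that the left end of the element n is the edge ord_pred n. *)
Definition is_mesh (R : realType) (N : nat) (x : nat -> R) : Prop :=
  forall n, (n < N)%N -> x n < x n.+1.

Definition elt_size (R : realType) (x : nat -> R) (n : nat) : R :=
  x n.+1 - x n.

Definition jac (R : realType) (x : nat -> R) (n : nat) : R := elt_size x n / 2.

(* A piecewise polynomial function is stored elementwise as a polynomial in the
   reference coordinate r; phys x n v is the same function on the element n, as
   a polynomial in the physical coordinate, by the inverse of the affine map
   r |-> (1 - r) / 2 * x n + (1 + r) / 2 * x n.+1. *)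
Definition field (R : realType) (N : nat) : Type := 'I_N -> {poly R}.

Definition pw_poly (R : realType) (p N : nat) (v : field R N) : Prop :=
  forall n, (size (v n) <= p.+1)%N.

Definition phys (R : realType) (x : nat -> R) (n : nat) (v : {poly R}) :
    {poly R} :=
  v \Po ((elt_size x n)^-1 *: (2 *: 'X - (x n + x n.+1)%:P)).

Definition trace_minus (R : realType) (N : nat) (v : field R N) (e : 'I_N) : R :=
  (v e).[1].

Definition trace_plus (R : realType) (N : nat) (v : field R N) (e : 'I_N) : R :=
  (v (ordS e)).[-1].

Definition jump (R : realType) (N : nat) (v : field R N) (e : 'I_N) : R :=
  trace_minus v e - trace_plus v e.

Definition avg (R : realType) (N : nat) (v : field R N) (e : 'I_N) : R :=
  (trace_minus v e + trace_plus v e) / 2.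

(* The elementwise derivative in the physical coordinate, read in r. *)
Definition grad (R : realType) (N : nat) (x : nat -> R) (u : field R N) :
    field R N :=
  fun n => (jac x n)^-1 *: (u n)^`().

(* lift e d is the function r^e obtained for the value d of the jump at e. *)
Definition is_lifting (R : realType) (p N : nat) (x : nat -> R)
    (lift : 'I_N -> R -> field R N) : Prop :=
  forall (e : 'I_N) (d : R),
    pw_poly p (lift e d) /\
    forall phi : field R N, pw_poly p phi ->
      \sum_(n < N) \int[lebesgue_measure]_(y in `[x n, x n.+1])
        ((phys x n (lift e d n)).[y] * (phys x n (phi n)).[y])
      = - d * avg phi e.

Definition ustar (R : realType) (N : nat) (u : field R N) (e : 'I_N) : R :=
  avg u e.

Definition qstar (R : realType) (N : nat) (x : nat -> R) (s : R)
    (lift : 'I_N -> R -> field R N) (u : field R N) (e : 'I_N) : R :=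
  avg (grad x u) e + s * avg (lift e (jump u e)) e.

Definition corrected_grad (R : realType) (p N : nat) (x : nat -> R) (kappa : R)
    (u : field R N) : field R N :=
  fun n => (jac x n)^-1 *:
    ((u n)^`()
     + (ustar u (ord_pred n) - (u n).[-1]) *: (corrL p kappa)^`()
     + (ustar u n - (u n).[1]) *: (corrR p kappa)^`()).

Definition scheme_rhs (R : realType) (p N : nat) (x : nat -> R)
    (b kappa c s : R) (lift : 'I_N -> R -> field R N) (u : field R N) :
    field R N :=
  let q := corrected_grad p x kappa u in
  fun n => (b / jac x n) *:
    ((q n)^`()
     + (qstar x s lift u (ord_pred n) - (q n).[-1]) *: (corrL p c)^`()
     + (qstar x s lift u n - (q n).[1]) *: (corrR p c)^`()).

(* The mesh being fixed in time, the time derivative at a fixed point of the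
   element n is the time derivative at a fixed r. *)
Definition scheme_solution (R : realType) (p N : nat) (x : nat -> R)
    (b kappa c s : R) (lift : 'I_N -> R -> field R N) (T : R)
    (u : R -> field R N) : Prop :=
  forall t : R, 0 < t < T ->
    pw_poly p (u t) /\
    forall (n : 'I_N) (r : R), -1 <= r <= 1 ->
      is_derive t (1 : R) (fun tau => (u tau n).[r])
        (scheme_rhs p x b kappa c s lift (u t) n).[r].

Definition Theta (R : realType) (p N : nat) (x : nat -> R) (kappa s : R)
    (lift : 'I_N -> R -> field R N) (u : field R N) (e : 'I_N) : R :=
  let q := corrected_grad p x kappa u in
  (trace_plus u e * trace_plus q e - trace_minus u e * trace_minus q e)
  - qstar x s lift u e * (trace_plus u e - trace_minus u e)
  - ustar u e * (trace_plus q e - trace_minus q e).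

Definition energy_norm (R : realType) (p N : nat) (x : nat -> R) (c : R)
    (u : field R N) : R :=
  Num.sqrt (\sum_(n < N) \int[lebesgue_measure]_(y in `[x n, x n.+1])
    ((phys x n (u n)).[y] ^+ 2
     + c / 2 * jac x n ^+ (2 * p) * ((phys x n (u n))^`(p)).[y] ^+ 2)).

(* Main.v *)
Require Import Defs.
From HB Require Import structures.
From mathcomp Require Import all_boot all_order all_algebra.
From mathcomp Require Import all_classical all_reals all_analysis.
From mathcomp Require Import ring lra zify.
Set Implicit Arguments.
Unset Strict Implicit.
Unset Printing Implicit Defensive.
Import Order.TTheory GRing.Theory Num.Theory.
Import numFieldNormedType.Exports.
Local Open Scope classical_set_scope.
Local Open Scope ring_scope.

(* With J_e the jump of u at the edge e, Theta_e = J_e (q* - {{q}}), and both the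
   lifting operator and q - grad u are explicit in the jumps: they involve only the
   end values of the correction derivatives. The sum of the Theta_e then splits into
   one quadratic form in the two end jumps of each element, diagonally dominated
   once s > s*. For the energy, the derivatives of the ESFR correction functions
   represent the end point evaluations for the form
   B_c(v, w) = int v w + c v^(p) w^(p) on [-1, 1], so that half the time derivative of
   the energy is b (sum Theta_e - sum_n J_n B_kappa(q_n, q_n)). Finally the scheme does
   not depend on kappa: a change of kappa moves q_n along the Legendre polynomial
   of degree p, whose derivative is (-1)^p h_L' + h_R', so kappa may be taken
   minimizing. *)

(** * Integration of polynomials over [-1, 1] *)

Definition antideriv (R : realType) (f : {poly R}) : {poly R} :=
  \poly_(i < (size f).+1) (f`_i.-1 / i%:R).

(** The index 0 is no exception: division by [0%:R] gives 0, so this primitive has no constant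
    term. *)
Lemma coef_antideriv (R : realType) (f : {poly R}) i :
  (antideriv f)`_i = f`_i.-1 / i%:R.
Proof.
rewrite coef_poly; case: ltnP => //; case: i => [|i] //= lef.
by rewrite nth_default ?mul0r.
Qed.

Lemma antideriv_is_linear (R : realType) : linear (@antideriv R).
Proof.
by move=> a f g; apply/polyP => i; rewrite !(coef_antideriv, coefD, coefZ); ring.
Qed.

HB.instance Definition _ (R : realType) :=
  GRing.isLinear.Build R {poly R} {poly R} *:%R (@antideriv R)
    (@antideriv_is_linear R).

Lemma deriv_antideriv (R : realType) (f : {poly R}) : (antideriv f)^`() = f.
Proof.
by apply/polyP => i; rewrite coef_deriv coef_antideriv /= -(mulr_natr (f`_i / _)) divfK //.
Qed.

(** The integral over the reference element, kept algebraic; [Rintegral_horner] ties it to the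
    Lebesgue integral. *)
Definition refint (R : realType) (f : {poly R}) : R :=
  (antideriv f).[1] - (antideriv f).[-1].

Lemma refint_is_linear (R : realType) : scalar (@refint R).
Proof.
by move=> a f g; rewrite /refint linearP /= !hornerD !hornerZ mulrBr opprD addrACA.
Qed.

HB.instance Definition _ (R : realType) :=
  GRing.isLinear.Build R {poly R} R *%R (@refint R) (@refint_is_linear R).

Lemma eq_deriv_horner (R : realType) (f g : {poly R}) (a b : R) :
  f^`() = g^`() -> f.[a] - f.[b] = g.[a] - g.[b].
Proof.
move=> fg; have : (f - g)^`() = 0 by rewrite derivB fg subrr.
move=> /polyP d0; have /size1_polyC e : (size (f - g)%R <= 1)%N.
  apply/leq_sizeP => -[//|i] _; have := d0 i; rewrite coef_deriv coef0.
  by move/eqP; rewrite mulrn_eq0 /= => /eqP.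
by rewrite -[f](subrK g) e !hornerE; ring.
Qed.

Lemma refint_deriv (R : realType) (f : {poly R}) :
  refint f^`() = f.[1] - f.[-1].
Proof. by apply: eq_deriv_horner; rewrite deriv_antideriv. Qed.

Lemma refint_parts (R : realType) (f g : {poly R}) :
  refint (f * g^`()) = f.[1] * g.[1] - f.[-1] * g.[-1] - refint (f^`() * g).
Proof.
have := refint_deriv (f * g); rewrite derivM linearD !hornerM /=; lra.
Qed.

(** * Legendre polynomials from Rodrigues' formula *)

Section Legendre.
Variable R : realType.
Implicit Types (f g v w : {poly R}) (a : R).
Local Notation W := ('X^2 - 1 : {poly R}).
Local Notation L := (legendre R).

Lemma deriv_W : W^`() = 2%:R *: 'X.
Proof. by rewrite derivB derivXn derivC subr0 expr1 scaler_nat. Qed.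

Lemma W_end a : a ^+ 2 = 1 -> W.[a] = 0.
Proof. by move=> a2; rewrite hornerD hornerXn hornerN hornerC a2 subrr. Qed.

Lemma deriv_W_exp (k : nat) :
  (W ^+ k.+1)^`() = k.+1%:R *: ((2%:R *: 'X) * W ^+ k).
Proof. by rewrite deriv_exp deriv_W [k.+1%:R *: _]scaler_nat. Qed.

(** Each derivative removes at most one factor [W]. At an end point [W] is 0 and its derivative is
    [2 * a], so only the terms that differentiate the power of [W] survive; their exponents build
    the falling factorial. *)
Lemma derivn_W_exp (m j : nat) : (j <= m)%N ->
  exists h : {poly R}, (W ^+ m)^`(j) = W ^+ (m - j) * h /\
    forall a : R, a ^+ 2 = 1 -> h.[a] = (2 * a) ^+ j * (m ^_ j)%:R.
Proof.
elim: j => [|j IH] jm.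
  by exists 1; rewrite subn0 mulr1; split=> // a _; rewrite hornerC ffactn0 mulr1 expr0.
have [h [e ha]] := IH (ltnW jm).
exists ((m - j)%:R *: (2%:R *: 'X) * h + W * h^`()); split.
  rewrite derivnS e derivM subnS.
  have [k ->] : exists k, (m - j = k.+1)%N by exists (m - j).-1; rewrite prednK ?subn_gt0.
  by rewrite deriv_W_exp /= -!mul_polyC; move: W => w; rewrite exprS; ring.
move=> a a2; rewrite hornerD !hornerM W_end // !hornerZ hornerX ha // ffactnSr natrM mul0r addr0 exprS; ring.
Qed.

Lemma root_derivn_W_exp (m j : nat) a : (j < m)%N -> a ^+ 2 = 1 ->
  ((W ^+ m)^`(j)).[a] = 0.
Proof.
move=> jm a2; have [h [-> _]] := @derivn_W_exp m j (ltnW jm).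
by rewrite hornerM horner_exp W_end // expr0n subn_eq0 leqNgt jm mul0r.
Qed.

Lemma legendre_end (m : nat) a : a ^+ 2 = 1 -> (L m).[a] = a ^+ m.
Proof.
move=> a2; rewrite /legendre hornerZ; have [h [-> ha]] := @derivn_W_exp m m (leqnn m).
rewrite subnn expr0 mul1r ha // ffactnn natrM natrX exprMn.
have : (m`!)%:R != 0 :> R by rewrite pnatr_eq0 -lt0n fact_gt0.
have : 2 ^+ m != 0 :> R by rewrite expf_neq0 // pnatr_eq0.
by move=> ? ?; field; apply/andP.
Qed.

Lemma legendre_orth (m : nat) v : (size v <= m)%N -> refint (v * L m) = 0.
Proof.
move=> sv; rewrite /legendre -scalerAr linearZ /=.
suff -> : refint (v * (W ^+ m)^`(m)) = 0 by rewrite mulr0.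
have H k : (k <= m)%N ->
    refint (v * (W ^+ m)^`(m)) = (-1) ^+ k * refint (v^`(k) * (W ^+ m)^`(m - k)).
  elim: k => [|k IH] km; first by rewrite subn0 expr0 mul1r derivn0.
  rewrite IH ?(ltnW km) // subnS.
  have [j ej] : exists j, (m - k = j.+1)%N.
    by exists (m - k).-1; rewrite prednK ?subn_gt0.
  have jm : (j < m)%N by rewrite -ej leq_subr.
  rewrite ej derivnS refint_parts /= !root_derivn_W_exp ?expr1n ?sqrrN ?expr1n //.
  by rewrite !mulr0 subrr sub0r (exprS (-1 : R)) mulN1r mulNr mulrN.
rewrite (H m) // (_ : v^`(m) = 0) ?mul0r ?linear0 ?mulr0 //.
by apply/polyP => i; rewrite coef_derivn coef0 nth_default ?mul0rn // (leq_trans sv) ?leq_addr.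
Qed.

Lemma W_exp_monic m : W ^+ m \is monic.
Proof. by apply: monic_exp; rewrite -[1]/(1%:P) monicXnsubC. Qed.

Lemma size_W_exp m : size (W ^+ m) = (2 * m).+1.
Proof.
elim: m => [|m IH]; first by rewrite expr0 size_poly1.
have sW : size W = 3%N by rewrite -[1]/(1%:P) size_XnsubC.
rewrite exprS size_monicM ?monic_neq0 ?W_exp_monic // ?sW ?IH; first by rewrite mulnS.
by rewrite -[1]/(1%:P) monicXnsubC.
Qed.

Lemma size_legendre m : (size (L m) <= m.+1)%N.
Proof.
apply: (leq_trans (size_scale_leq _ _)); apply/leq_sizeP => i mi.
rewrite coef_derivn nth_default ?mul0rn // size_W_exp mul2n -addnn -addnS.
by rewrite leq_add2l.
Qed.

Lemma legendre_lead m : (L m)`_m = acoef R m.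
Proof.
rewrite coefZ coef_derivn addnn -mul2n.
have -> : (W ^+ m)`_(2 * m) = 1.
  by move/monicP: (W_exp_monic m); rewrite lead_coefE size_W_exp.
have f0 : (m`!)%:R != 0 :> R by rewrite pnatr_eq0 -lt0n fact_gt0.
have p0 : 2 ^+ m != 0 :> R by rewrite expf_neq0 // pnatr_eq0.
have : ((2 * m) ^_ m * m`!)%:R = (2 * m)`!%:R :> R.
  by rewrite -[in RHS](@ffact_fact (2 * m) m) ?leq_pmull // mul2n -addnn addnK.
rewrite /acoef !natrM => <-; rewrite !natrX; field.
by apply/andP.
Qed.

(** The second derivative of W^(m+1), after replacing X^2 by W + 1, is a combination of W^m and
    W^(m-1). Differentiated m times, the second part is exactly the derivative of
    [legendre R m.-1]. *)
Lemma legendre_rec m : (0 < m)%N ->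
  (L m.+1)^`() - (L m.-1)^`() = (2 * m + 1)%N%:R *: L m.
Proof.
case: m => // m _ /=; rewrite /legendre.
have D2 : (W ^+ m.+2)^`()^`() = (2 * (m.+2 * (2 * m.+1 + 1)))%N%:R *: W ^+ m.+1
    + (4 * (m.+2 * m.+1))%N%:R *: W ^+ m.
  rewrite !(deriv_W_exp, derivZ, derivM, derivX).
  have XX : 'X * 'X = W + 1 by rewrite subrK.
  move: W XX => w XX; rewrite -!mul_polyC !polyC_natr exprS.
  rewrite (_ : _ * _ = m.+2%:R * (2 * w + 4 * m.+1%:R * ('X * 'X)) * w ^+ m); last ring.
  by rewrite XX !natrM !natrD !natrM; ring.
have e : (W ^+ m.+2)^`(m.+3) = (W ^+ m.+2)^`()^`()^`(m.+1) by rewrite !derivSn.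
have f0 k : (k`!)%:R != 0 :> R by rewrite pnatr_eq0 -lt0n fact_gt0.
have p0 : 2 ^+ m != 0 :> R by rewrite expf_neq0 // pnatr_eq0.
have n1 : 1 + m%:R != 0 :> R by rewrite lt0r_neq0 // ltr_pwDl.
have n2 : 2 + m%:R != 0 :> R by rewrite lt0r_neq0 // ltr_pwDl.
rewrite !derivZ -!derivnS e D2 derivnD !derivnZ !scalerDr !scalerA -addrA -scalerBl.
have -> : ((2 ^ m.+2 * (m.+2)`!)%N%:R)^-1 * (4 * (m.+2 * m.+1))%N%:R - ((2 ^ m * m`!)%N%:R)^-1 = 0 :> R.
  rewrite !factS !expnS !natrM natrX; field.
  by rewrite p0 f0 n1 n2.
rewrite scale0r addr0; congr (_ *: _).
rewrite !factS !expnS !natrM !natrD natrX; field.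
by rewrite p0 f0 n1 n2.
Qed.

Lemma deriv_legendre_end m a : a ^+ 2 = 1 ->
  ((L m)^`()).[a] = a ^+ m.+1 * (m * m.+1)%N%:R / 2.
Proof.
(* [legendre_rec] steps by two degrees, so the induction carries two consecutive ones. *)
move=> a2; suff [] : ((L m)^`()).[a] = a ^+ m.+1 * (m * m.+1)%N%:R / 2 /\
  ((L m.+1)^`()).[a] = a ^+ m.+2 * (m.+1 * m.+2)%N%:R / 2 by [].
elim: m => [|m [IH0 IH1]]; last first.
  split=> //; have /(congr1 (fun f => f.[a])) := legendre_rec (ltn0Sn m).
  rewrite /= hornerD hornerN hornerZ legendre_end // IH0 => /eqP.
  rewrite subr_eq => /eqP ->.
  have -> : a ^+ m.+3 = a ^+ m.+1 by rewrite !exprSr -!mulrA (mulrA a a) -expr2 a2 mul1r.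
  by rewrite !natrM !natrD natrM -!natr1; field.
have -> : L 0 = 1 by rewrite /legendre mul1n invr1 scale1r.
have -> : L 1 = 'X.
  by rewrite /legendre muln1 expn1 expr1 derivn1 deriv_W scalerA mulVf ?scale1r //.
rewrite derivC derivX !hornerC a2.
by split; rewrite ?mul0n ?mulr0 ?mul0r // mul1r divff ?pnatr_eq0.
Qed.

Lemma size_deriv_leq v m : (size v <= m.+1)%N -> (size v^`() <= m)%N.
Proof.
by move=> sv; apply/leq_sizeP => i mi; rewrite coef_deriv nth_default ?mul0rn // (leq_trans sv).
Qed.

Lemma refint_deriv_legendre v m : (0 < m)%N -> (size v <= m.+1)%N ->
  (2 * m + 1)%N%:R * refint (v * L m) = refint (v^`() * L m.-1).
Proof.
move=> m0 sv; rewrite -linearZ /= scalerAr -legendre_rec // mulrBr linearB /=.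
rewrite !refint_parts !legendre_end ?sqrrN ?expr1n //.
have -> : refint (v^`() * L m.+1) = 0.
  by apply: legendre_orth; rewrite (leq_trans (size_deriv_leq sv)) // ltnW.
case: m m0 sv => // m _ sv; rewrite /= !(exprSr (-1) _) ?expr1n; ring.
Qed.

(** As before with [v] equal to [L m], but now both integrals vanish by orthogonality and the
    boundary term gives 2. *)
Lemma refint_legendre_sqr m : (0 < m)%N -> (2 * m + 1)%N%:R * refint (L m * L m) = 2.
Proof.
move=> m0; rewrite -linearZ /= scalerAr -legendre_rec // mulrBr linearB /=.
rewrite refint_parts !legendre_end ?sqrrN ?expr1n //.
have -> : refint ((L m)^`() * L m.+1) = 0.
  by apply: legendre_orth; rewrite (leq_trans (size_deriv_leq (size_legendre m))) // ltnW.
have -> : refint (L m * (L m.-1)^`()) = 0.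
  rewrite mulrC; apply: legendre_orth.
  by rewrite (leq_trans (size_deriv_leq (size_legendre _))) // leq_pred.
have e : (-1) ^+ m * (-1) ^+ m = 1 :> R by rewrite -exprD addnn -mul2n exprM sqrrN !expr1n.
rewrite (exprSr (-1)); lra.
Qed.
End Legendre.

(** * Lebesgue integrals of polynomials on the elements *)

Section Integral.
Variable R : realType.
Implicit Types (f v : {poly R}) (x : nat -> R).

Lemma Rintegral_horner f (a b : R) : a < b ->
  \int[lebesgue_measure]_(y in `[a, b]) f.[y] =
  (antideriv f).[b] - (antideriv f).[a].
Proof.
move=> ab; rewrite /Rintegral (@continuous_FTC2 _ _ (horner (antideriv f))) //.
- by apply: continuous_subspaceT; exact: continuous_horner.
- split=> [y _||]; first exact: derivable_horner.
  + by apply: cvg_at_right_filter; exact: continuous_horner.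
  + by apply: cvg_at_left_filter; exact: continuous_horner.
- by move=> y _; rewrite -derivE deriv_antideriv.
Qed.

Lemma refint_sqr_ge0 v : 0 <= refint (v * v).
Proof.
rewrite /refint -Rintegral_horner; last by rewrite -subr_gt0 opprK.
by apply: Rintegral_ge0 => y _; rewrite hornerM -expr2 sqr_ge0.
Qed.

(** The change of variables is made on primitives: [jac x n *: phys x n (antideriv f)] is one for
    [phys x n f]. *)
Lemma Rintegral_phys x n f : x n < x n.+1 ->
  \int[lebesgue_measure]_(y in `[x n, x n.+1]) (phys x n f).[y] =
  jac x n * refint f.
Proof.
move=> xn; rewrite Rintegral_horner //.
have h0 : x n.+1 - x n != 0 by rewrite subr_eq0 gt_eqF.
rewrite (@eq_deriv_horner _ _ (jac x n *: phys x n (antideriv f))).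
  rewrite /refint /phys /jac /elt_size !(hornerZ, horner_comp, hornerD, hornerN, hornerX, hornerC).
  have -> : (x n.+1 - x n)^-1 * (2 * x n.+1 - (x n + x n.+1)) = 1 by field.
  have -> : (x n.+1 - x n)^-1 * (2 * x n - (x n + x n.+1)) = -1 by field.
  by rewrite -mulrBr.
rewrite deriv_antideriv derivZ deriv_comp deriv_antideriv derivZ derivB derivZ derivX derivC subr0.
rewrite -/(phys x n f) -!scalerAr mulr1 !scalerA /jac /elt_size.
have -> : (x n.+1 - x n) / 2 * ((x n.+1 - x n)^-1 * 2) = 1 by field.
by rewrite scale1r.
Qed.
End Integral.

(** * ESFR correction functions and the bilinear form they represent *)

Section Correction.
Variables (R : realType) (p : nat).
Hypothesis p_gt0 : (0 < p)%N.
Implicit Types (f g v w : {poly R}) (k : R).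
Local Notation L := (legendre R).

(** The parameter enters the derivatives of the correction functions only through this coefficient
    of [legendre R p]. *)
Definition weight k : R := (2 * p + 1)%N%:R / (1 + Defs.eta p k).

Lemma acoef_gt0 : 0 < acoef R p * p`!%:R.
Proof.
by rewrite mulr_gt0 ?divr_gt0 ?ltr0n ?muln_gt0 ?expn_gt0 ?fact_gt0.
Qed.

Let d : R := (2 * p + 1)%N%:R * (acoef R p * p`!%:R) ^+ 2.

Let d_gt0 : 0 < d.
Proof. by rewrite mulr_gt0 ?exprn_gt0 ?acoef_gt0 // ltr0n addn1. Qed.

Let etaE k : Defs.eta p k = k * d / 2.
Proof. by rewrite /Defs.eta -(mulrA k). Qed.

Lemma eta_cminus k : (cminus R p < k) = (0 < 1 + Defs.eta p k).
Proof.
rewrite etaE /cminus -/d; move: d_gt0; move: d => D D0.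
rewrite -subr_gt0 opprK -(pmulr_lgt0 (k + _) D0) mulrDl divfK ?gt_eqF //.
by apply/idP/idP; lra.
Qed.

(** [legendre_rec] trades the derivative of [L p.+1] for that of [L p.-1] plus a multiple of [L p];
    the weighted mean in [corrL] then collapses. *)
Lemma deriv_corrL k : 1 + Defs.eta p k != 0 ->
  (corrL p k)^`() =
  ((-1) ^+ p / 2) *: ((L p)^`() - (L p.-1)^`() - weight k *: L p).
Proof.
move=> t0; rewrite /corrL (derivZ _ (_ - _)) derivB (derivZ _ (_ + _)) derivD.
rewrite (derivZ (Defs.eta p k)).
have /eqP := legendre_rec R p_gt0; rewrite subr_eq => /eqP ->.
congr (_ *: _); rewrite /weight -addrA; congr (_ + _); rewrite -opprD; congr (- _).
rewrite addrCA -[X in _ + (_ + X)]scale1r -scalerDl [Defs.eta p k + 1]addrC.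
by rewrite scalerDr !scalerA mulVf // scale1r addrC [_^-1 * _]mulrC.
Qed.

Lemma deriv_corrR k : 1 + Defs.eta p k != 0 ->
  (corrR p k)^`() = (1 / 2) *: ((L p)^`() + (L p.-1)^`() + weight k *: L p).
Proof.
move=> t0; rewrite /corrR (derivZ _ (_ + _)) derivD (derivZ _ (_ + _)) derivD.
rewrite (derivZ (Defs.eta p k)).
have /eqP := legendre_rec R p_gt0; rewrite subr_eq => /eqP ->.
congr (_ *: _); rewrite /weight -addrA; congr (_ + _).
rewrite addrCA -[X in _ + (_ + X)]scale1r -scalerDl [Defs.eta p k + 1]addrC.
by rewrite scalerDr !scalerA mulVf // scale1r addrC [_^-1 * _]mulrC.
Qed.

Lemma corr_end k : 1 + Defs.eta p k != 0 ->
  [/\ ((corrL p k)^`()).[1] = (-1) ^+ p / 2 * (p%:R - weight k),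
      ((corrL p k)^`()).[-1] = - (p%:R ^+ 2 + weight k) / 2,
      ((corrR p k)^`()).[1] = (p%:R ^+ 2 + weight k) / 2 &
      ((corrR p k)^`()).[-1] = (-1) ^+ p / 2 * (weight k - p%:R)].
Proof.
move=> t0; rewrite deriv_corrL // deriv_corrR //.
have a1 : 1 ^+ 2 = 1 :> R by rewrite expr1n.
have a2 : (- 1) ^+ 2 = 1 :> R by rewrite sqrrN expr1n.
move: (legendre_end p a1) (legendre_end p a2) (deriv_legendre_end p a1) (deriv_legendre_end p a2).
move: (deriv_legendre_end p.-1 a1) (deriv_legendre_end p.-1 a2).
move: (L p) (L p.-1) => P Q; rewrite prednK // !expr1n => q1 q2 v1 v2 d1 d2.
rewrite !(hornerZ, hornerD, hornerN) q1 q2 v1 v2 d1 d2.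
have -> : (-1) ^+ p.+1 = - (-1) ^+ p :> R by rewrite exprS mulN1r.
have e : (-1) ^+ p * (-1) ^+ p = 1 :> R by rewrite -exprD addnn -mul2n exprM sqrrN !expr1n.
rewrite !natrM -natr1.
have -> : p.-1%:R = p%:R - 1 :> R by rewrite -(natrB _ p_gt0) subn1.
move: ((-1) ^+ p) e => o e.
split; [by field | | by field | by field].
transitivity (o * o * (- (p%:R ^+ 2 + weight k) / 2)); first by field.
by rewrite e mul1r.
Qed.

Lemma gL_gapE k : cminus R p < k ->
  gL_gap p k = (`|p%:R - weight k| + p%:R ^+ 2 + weight k) / 2.
Proof.
rewrite eta_cminus => /lt0r_neq0/corr_end[e1 e2 _ _].
rewrite /gL_gap e1 e2 !normrM normrX normrN1 expr1n mul1r ger0_norm ?invr_ge0 //.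
by field.
Qed.

(** By [gL_gapE] this is |p - w| + w >= p for w = [weight k], with equality iff w <= p: the minimum
    is reached on a whole range of parameters. *)
Lemma gL_gap_min k : cminus R p < k ->
  (p * p.+1)%N%:R / 2 <= gL_gap p k ?= iff (weight k <= p%:R).
Proof.
move=> k0; rewrite gL_gapE // natrM -natr1.
case: (leP (weight k) p%:R) => wp.
  rewrite ger0_norm ?subr_ge0 //; apply/leifP.
  by rewrite (_ : _ / _ = (p%:R - weight k + p%:R ^+ 2 + weight k) / 2) //; field.
by rewrite ltr0_norm ?subr_lt0 //; apply/leifP; lra.
Qed.

Lemma weight_attained : exists2 k : R, cminus R p < k & weight k <= p%:R.
Proof.
(* With [eta] equal to 2 the weight is (2 p + 1) / 3, which is at most p as soon as p >= 1. *)
have e : Defs.eta p (4 / d) = 2 by rewrite etaE divfK ?gt_eqF //; field.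
exists (4 / d); first by rewrite eta_cminus e; lra.
rewrite /weight e; have : 1 <= p%:R :> R by rewrite ler1n.
by move=> p1; rewrite ler_pdivrMr ?natrD ?natrM; lra.
Qed.

(* p`! * v`_p is the p-th derivative of v, a constant when size v <= p.+1; its
   integral over [-1, 1] turns the c / 2 of energy_norm into c. *)
Definition esfr_form k v w : R :=
  refint (v * w) + k * (p`!%:R ^+ 2 * (v`_p * w`_p)).

Lemma esfr_form_is_linear k v : scalar (esfr_form k v).
Proof.
move=> a f g; rewrite /esfr_form mulrDr -scalerAr linearP /= coefD coefZ.
by move: (refint _) (refint _) => F G; ring.
Qed.

HB.instance Definition _ k v :=
  GRing.isLinear.Build R {poly R} R *%R (esfr_form k v)
    (@esfr_form_is_linear k v).

Lemma esfr_formC k v w : esfr_form k v w = esfr_form k w v.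
Proof. by rewrite /esfr_form mulrC [v`_p * _]mulrC. Qed.

Let acoef_neq0 : acoef R p != 0.
Proof. by apply: contraTneq acoef_gt0 => ->; rewrite mul0r ltxx. Qed.

Lemma legendre_split v : (size v <= p.+1)%N ->
  exists2 z : {poly R}, (size z <= p)%N & v = z + (v`_p / acoef R p) *: L p.
Proof.
move=> sv; exists (v - (v`_p / acoef R p) *: L p); last by rewrite subrK.
apply/leq_sizeP => j; rewrite leq_eqVlt => /predU1P[<-|pj].
  by rewrite coefB coefZ legendre_lead divfK // subrr.
rewrite coefB coefZ (nth_default _ (leq_trans sv pj)).
by rewrite (nth_default _ (leq_trans (size_legendre R p) pj)) mulr0 subrr.
Qed.

(** Against [L p] the top coefficient term multiplies the plain integral by 1 + [eta], and
    [weight k] divides by it; [refint_deriv_legendre] does the rest. *)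
Lemma esfr_form_legendre k v : (size v <= p.+1)%N -> 1 + Defs.eta p k != 0 ->
  weight k * esfr_form k v (L p) = refint (v^`() * L p.-1).
Proof.
move=> sv t0; rewrite -refint_deriv_legendre // /weight /esfr_form legendre_lead.
have [z sz ev] := legendre_split sv.
have rv : (2 * p + 1)%N%:R * refint (v * L p) = v`_p / acoef R p * 2.
  rewrite {1}ev mulrDl linearD /= legendre_orth //.
  by rewrite add0r -scalerAl linearZ /= mulrCA refint_legendre_sqr.
rewrite mulrAC; apply: (canLR (mulfK t0)).
by rewrite [RHS]mulrDr mulr1 mulrDr rv etaE /d; field.
Qed.

(** Splitting off the [L p] component diagonalizes the form: a plain square integral plus a square
    times a positive multiple of 1 + [eta]. Negative parameters above [cminus R p] are thus
    covered. *)
Lemma esfr_form_ge0 k v : cminus R p < k -> (size v <= p.+1)%N ->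
  0 <= esfr_form k v v.
Proof.
rewrite eta_cminus => t0 sv; have [z sz ev] := legendre_split sv.
have n0 : 0 < (2 * p + 1)%N%:R :> R by rewrite ltr0n addn1.
have LL : refint (L p * L p) = 2 / (2 * p + 1)%N%:R.
  by rewrite -(refint_legendre_sqr R p_gt0) mulrAC divff ?mul1r // gt_eqF.
have -> : esfr_form k v v = refint (z * z)
    + (v`_p / acoef R p) ^+ 2 * (2 * (1 + Defs.eta p k) / (2 * p + 1)%N%:R).
  rewrite /esfr_form; have -> : refint (v * v) = refint (z * z)
      + (v`_p / acoef R p) ^+ 2 * (2 / (2 * p + 1)%N%:R).
    move: (L p) (legendre_orth sz) LL ev => P zP PP ev.
    rewrite {1 2}ev; move: (_ / acoef R p) => a.
    rewrite mulrDl !mulrDr !linearD /= -[(a *: P) * z]scalerAl -[(a *: P) * _]scalerAl.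
    rewrite -[z * (a *: P)]scalerAr -[P * (a *: P)]scalerAr !linearZ /=.
    by rewrite [P * z]mulrC zP PP; field; rewrite gt_eqF.
  rewrite etaE /d.
  by field; rewrite acoef_neq0 gt_eqF.
by rewrite addr_ge0 ?refint_sqr_ge0 // mulr_ge0 ?sqr_ge0 // divr_ge0 ?mulr_ge0 ?ltW.
Qed.

Lemma coef_deriv_legendre (m : nat) : (m <= p)%N -> ((L m)^`())`_p = 0.
Proof.
by move=> mp; rewrite nth_default // (leq_trans (size_deriv_leq (size_legendre R m))).
Qed.

(** Integration by parts of the [L p.-1] term leaves the integral that the [weight] term cancels.
    The boundary values cancel at 1, and at -1 they add up because the parities of p and p - 1
    differ. *)
Lemma esfr_form_corrL k v : (size v <= p.+1)%N -> 1 + Defs.eta p k != 0 ->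
  esfr_form k v (corrL p k)^`() = - v.[-1].
Proof.
move=> sv t0; rewrite deriv_corrL // linearZ /= 2!linearB /= [esfr_form k v (weight k *: _)]linearZ /=.
rewrite esfr_form_legendre // /esfr_form !coef_deriv_legendre ?leq_pred // !mulr0 !addr0.
rewrite !refint_parts !legendre_end ?sqrrN ?expr1n //.
rewrite [refint (_ * L p)]legendre_orth ?size_deriv_leq //.
have e : (-1) ^+ p.-1 = - (-1) ^+ p :> R by rewrite -[in RHS](prednK p_gt0) exprS mulN1r opprK.
have o : (-1) ^+ p * (-1) ^+ p = 1 :> R by rewrite -exprD addnn -mul2n exprM sqrrN !expr1n.
rewrite e; move: ((-1) ^+ p) o (refint _) => o o1 r.
transitivity (- (o * o) * v.[-1]); first by field.
by rewrite o1 mulN1r.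
Qed.

Lemma esfr_form_corrR k v : (size v <= p.+1)%N -> 1 + Defs.eta p k != 0 ->
  esfr_form k v (corrR p k)^`() = v.[1].
Proof.
move=> sv t0; rewrite deriv_corrR // linearZ /= 2!linearD /= [esfr_form k v (weight k *: _)]linearZ /=.
rewrite esfr_form_legendre // /esfr_form !coef_deriv_legendre ?leq_pred // !mulr0 !addr0.
rewrite !refint_parts !legendre_end ?sqrrN ?expr1n //.
rewrite [refint (_ * L p)]legendre_orth ?size_deriv_leq //.
have e : (-1) ^+ p.-1 = - (-1) ^+ p :> R by rewrite -[in RHS](prednK p_gt0) exprS mulN1r opprK.
by rewrite e; move: ((-1) ^+ p) (refint _) => o r; field.
Qed.

Lemma size_deriv_corr k :
  (size (corrL p k)^`() <= p.+1)%N /\ (size (corrR p k)^`() <= p.+1)%N.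
Proof.
have s0 : (size (L p) <= p.+2)%N by rewrite (leq_trans (size_legendre _ _)).
have s1 := size_legendre R p.+1.
have s2 : (size (L p.-1) <= p.+2)%N.
  by rewrite (leq_trans (size_legendre _ _)) // prednK // leqW.
rewrite /corrL /corrR; move: (L p) (L p.+1) (L p.-1) s0 s1 s2 => P Q S s0 s1 s2.
by split; apply/size_deriv_leq/leq_sizeP => i pi;
  rewrite !(coefZ, coefN, coefD) (nth_default _ (leq_trans s0 pi))
    (nth_default _ (leq_trans s1 pi)) (nth_default _ (leq_trans s2 pi))
    !(mulr0, addr0, oppr0).
Qed.

End Correction.

(** * The energy norm and the semi-discrete operator on one element *)

Section Energy.
Variables (R : realType) (p N : nat) (x : nat -> R).
Hypotheses (p_gt0 : (0 < p)%N) (mesh : is_mesh N x).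
Implicit Types (v w q : {poly R}) (k c s : R) (u : field R N).

Lemma refint_polyC (a : R) : refint a%:P = 2 * a.
Proof.
have -> : a%:P = (a *: 'X)^`() by rewrite derivZ derivX -mul_polyC mulr1.
by rewrite refint_deriv !hornerZ !hornerX; ring.
Qed.

Lemma derivn_top v : (size v <= p.+1)%N -> v^`(p) = (v`_p * p`!%:R)%:P.
Proof.
move=> sv; apply/polyP => -[|i]; rewrite coef_derivn coefC /=.
  by rewrite addn0 ffactnn mulr_natr.
by rewrite nth_default ?mul0rn // (leq_trans sv) // addnS ltnS leq_addr.
Qed.

Lemma jac_gt0 (n : 'I_N) : 0 < jac x n.
Proof. by rewrite divr_gt0 ?subr_gt0 ?mesh. Qed.

Lemma phys_derivn n v m :
  (phys x n v)^`(m) = phys x n ((jac x n)^-1 ^+ m *: v^`(m)).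
Proof.
elim: m => [|m IH]; first by rewrite expr0 scale1r.
rewrite derivnS IH /phys deriv_comp !derivZ derivB derivZ derivX derivC subr0.
rewrite -derivnS !comp_polyZ -!scalerAr mulr1 !scalerA.
by congr (_ *: _); rewrite exprSr /jac invf_div; ring.
Qed.

(** The power of [jac x n] in the norm absorbs the chain rule factors of [phys_derivn], and the p-th
    derivative is constant. *)
Lemma energy_elt (n : 'I_N) c v : (size v <= p.+1)%N ->
  \int[lebesgue_measure]_(y in `[x n, x n.+1])
    ((phys x n v).[y] ^+ 2
     + c / 2 * jac x n ^+ (2 * p) * ((phys x n v)^`(p)).[y] ^+ 2)
  = jac x n * esfr_form p c v v.
Proof.
move=> sv.
transitivity (\int[lebesgue_measure]_(y in `[x n, x n.+1])
    (phys x n (v * v + (c / 2 * (v`_p * p`!%:R) ^+ 2)%:P)).[y]).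
  apply: eq_Rintegral => y _.
  rewrite phys_derivn derivn_top // -[_ *: _%:P]mul_polyC -polyCM /phys comp_polyC.
  rewrite comp_polyD comp_polyM comp_polyC hornerD hornerM !hornerC.
  have j0 := lt0r_neq0 (jac_gt0 n); congr (_ + _); rewrite mulnC exprM exprVn.
  move: (jac x n ^+ p) (expf_neq0 p j0) => j j1; by field.
rewrite Rintegral_phys ?mesh // linearD /= refint_polyC /esfr_form.
by congr (_ * (_ + _)); field.
Qed.

(** Squaring undoes [Num.sqrt] only on a nonnegative sum, whence the bound on [c]. *)
Lemma energy_normE c u : cminus R p < c -> pw_poly p u ->
  energy_norm p x c u ^+ 2 = \sum_(n < N) jac x n * esfr_form p c (u n) (u n).
Proof.
move=> c0 up; rewrite /energy_norm sqr_sqrtr.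
  by apply: eq_bigr => n _; exact: energy_elt.
apply: sumr_ge0 => n _; rewrite energy_elt //.
by rewrite mulr_ge0 ?esfr_form_ge0 // ltW // jac_gt0.
Qed.

Lemma legendre_corr c : 1 + Defs.eta p c != 0 ->
  (legendre R p)^`() = (-1) ^+ p *: (corrL p c)^`() + (corrR p c)^`().
Proof.
move=> t0; rewrite deriv_corrL // deriv_corrR //.
have o : (-1) ^+ p * (-1) ^+ p = 1 :> R by rewrite -exprD addnn -mul2n exprM sqrrN !expr1n.
rewrite scalerA mulrA o -scalerDr.
move: (legendre R p)^`() (legendre R p.-1)^`() (weight p c *: _) => a b e.
have -> : a - b - e + (a + b + e) = 2%:R *: a.
  by rewrite scaler_nat; ring.
by rewrite scalerA mul1r mulVf ?scale1r // pnatr_eq0.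
Qed.

(** The bracket of [scheme_rhs] with free interface values [l] and [r]. *)
Definition flux_rhs c (l r : R) q : {poly R} :=
  q^`() + (l - q.[-1]) *: (corrL p c)^`() + (r - q.[1]) *: (corrR p c)^`().

Lemma size_corrected_grad k u : pw_poly p u -> pw_poly p (corrected_grad p x k u).
Proof.
move=> up n; have [sL sR] := size_deriv_corr p_gt0 k.
have s0 : (size (u n)^`() <= p.+1)%N by rewrite ltnW // ltnS size_deriv_leq.
apply/leq_sizeP => i pi; rewrite /corrected_grad !(coefZ, coefD).
by rewrite (nth_default _ (leq_trans sL pi)) (nth_default _ (leq_trans sR pi))
  (nth_default _ (leq_trans s0 pi)) !(mulr0, addr0).
Qed.

Lemma size_flux_rhs c (l r : R) q : (size q <= p.+1)%N ->
  (size (flux_rhs c l r q) <= p.+1)%N.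
Proof.
move=> sq; have [sL sR] := size_deriv_corr p_gt0 c.
have s0 : (size q^`() <= p.+1)%N by rewrite ltnW // ltnS size_deriv_leq.
apply/leq_sizeP => i pi; rewrite /flux_rhs !(coefZ, coefD).
by rewrite (nth_default _ (leq_trans sL pi)) (nth_default _ (leq_trans sR pi))
  (nth_default _ (leq_trans s0 pi)) !(mulr0, addr0).
Qed.

(** The corrections represent end point evaluation, so they replace the traces of [q] by [l] and [r]
    in the boundary terms of the integration by parts. *)
Lemma esfr_form_flux_rhs c (l r : R) v q :
  1 + Defs.eta p c != 0 -> (size v <= p.+1)%N -> (size q <= p.+1)%N ->
  esfr_form p c v (flux_rhs c l r q) =
  r * v.[1] - l * v.[-1] - refint (v^`() * q).
Proof.
move=> t0 sv sq; rewrite /flux_rhs 2!linearD /= [esfr_form p c v ((l - _) *: _)]linearZ /=.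
rewrite [esfr_form p c v ((r - _) *: _)]linearZ /=.
rewrite esfr_form_corrL // esfr_form_corrR //.
have -> : esfr_form p c v q^`() = refint (v * q^`()).
  have q0 : (q^`())`_p = 0 by exact: nth_default (size_deriv_leq sq).
  by rewrite /esfr_form q0 !mulr0 addr0.
by rewrite refint_parts; ring.
Qed.
End Energy.

(** * The energy balance and its independence of kappa *)

Section Scheme.
Variables (R : realType) (p N : nat) (x : nat -> R).
Hypotheses (p_gt0 : (0 < p)%N) (mesh : is_mesh N x).
Variables (s : R) (lift : 'I_N -> R -> field R N).
Implicit Types (v w q : {poly R}) (k c b : R) (u : field R N).
Local Notation q_ k u := (corrected_grad p x k u).

(** The equation defining the corrected gradient, tested against that gradient itself in
    [esfr_form p k]. *)
Lemma refint_deriv_corrected_grad k u n :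
  1 + Defs.eta p k != 0 -> pw_poly p u ->
  refint ((u n)^`() * q_ k u n) =
  jac x n * esfr_form p k (q_ k u n) (q_ k u n)
  + (ustar u (ord_pred n) - (u n).[-1]) * (q_ k u n).[-1]
  - (ustar u n - (u n).[1]) * (q_ k u n).[1].
Proof.
move=> t0 up; have j0 := lt0r_neq0 (jac_gt0 mesh n).
have qp := size_corrected_grad x p_gt0 k up n.
set q := q_ k u n in qp *; set dL := ustar u (ord_pred n) - _; set dR := ustar u n - _.
have eq : jac x n *: q = (u n)^`() + dL *: (corrL p k)^`() + dR *: (corrR p k)^`().
  by rewrite /q /corrected_grad scalerA divff // scale1r.
have u0 : ((u n)^`())`_p = 0 by exact: nth_default (size_deriv_leq (up n)).
have := congr1 (esfr_form p k q) eq.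
rewrite 2!linearD /= [esfr_form p k q (jac x n *: _)]linearZ
  [esfr_form p k q (dL *: _)]linearZ [esfr_form p k q (dR *: _)]linearZ /=.
rewrite esfr_form_corrL // esfr_form_corrR // {2}/esfr_form u0 !mulr0 addr0.
by rewrite [(u n)^`() * q]mulrC => ->; ring.
Qed.

Lemma sum_edges (F G : 'I_N -> R) :
  \sum_(n < N) (F n + G (ord_pred n)) = \sum_(e < N) (F e + G e).
Proof.
rewrite !big_split; congr (_ + _).
by rewrite [RHS](reindex_inj (can_inj (@ord_predK N))).
Qed.

Lemma energy_identity k c b u :
  1 + Defs.eta p k != 0 -> 1 + Defs.eta p c != 0 -> pw_poly p u ->
  \sum_(n < N) jac x n * esfr_form p c (u n) (scheme_rhs p x b k c s lift u n) =
  b * (\sum_(e < N) Theta p x k s lift u e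
       - \sum_(n < N) jac x n * esfr_form p k (q_ k u n) (q_ k u n)).
Proof.
move=> tk tc up.
(* [F n] collects what the element [n] contributes at its right end, [G e] what the element [ordS e]
   contributes at its left end [e]. *)
pose F n := (ustar u n - (u n).[1]) * (q_ k u n).[1] + qstar x s lift u n * (u n).[1].
pose G e := - (ustar u e - (u (ordS e)).[-1]) * (q_ k u (ordS e)).[-1]
  - qstar x s lift u e * (u (ordS e)).[-1].
have -> : \sum_(e < N) Theta p x k s lift u e = \sum_(n < N) (F n + G (ord_pred n)).
  rewrite sum_edges; apply: eq_bigr => e _.
  rewrite /Theta /F /G /trace_plus /trace_minus; ring.
rewrite -sumrB mulr_sumr; apply: eq_bigr => n _.
rewrite /scheme_rhs -/(flux_rhs p c (qstar x s lift u (ord_pred n)) (qstar x s lift u n) (q_ k u n)).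
rewrite linearZ /= mulrA [jac x n * _]mulrC divfK ?lt0r_neq0 ?jac_gt0 //.
rewrite esfr_form_flux_rhs // ?size_corrected_grad // refint_deriv_corrected_grad //.
rewrite /F /G ord_predK; ring.
Qed.

(** Adding [m *: legendre R p] to q shifts its end values by m (-1)^p and m, so the correction terms
    lose m ((-1)^p h_L' + h_R'). By [legendre_corr] this is what the derivative of q gains. *)
Lemma scheme_rhs_kappa k k' c b u :
  1 + Defs.eta p k != 0 -> 1 + Defs.eta p k' != 0 -> 1 + Defs.eta p c != 0 ->
  scheme_rhs p x b k c s lift u = scheme_rhs p x b k' c s lift u.
Proof.
move=> t t' tc; apply/funext => n; rewrite /scheme_rhs; congr (_ *: _).
pose m := (jac x n)^-1 * ((ustar u (ord_pred n) - (u n).[-1]) * ((-1) ^+ p / 2) * (weight p k' - weight p k)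
   + (ustar u n - (u n).[1]) * (1 / 2) * (weight p k - weight p k')).
have -> : q_ k u n = q_ k' u n + m *: legendre R p.
  rewrite /corrected_grad !deriv_corrL // !deriv_corrR //.
  rewrite /m; move: (ustar u n - _) (ustar u (ord_pred n) - _) => dR dL.
  move: (weight p k) (weight p k') ((-1) ^+ p / 2) (1 / 2) (jac x n)^-1 => w w' g h j.
  move: (legendre R p) (legendre R p.-1)^`() => P Q.
  by rewrite -!mul_polyC !(polyCM, polyCB, polyCD); ring.
move: (q_ k' u n) => q; rewrite derivD [(m *: _)^`()]derivZ (legendre_corr p_gt0 tc).
have a1 : 1 ^+ 2 = 1 :> R by rewrite expr1n.
have a2 : (- 1) ^+ 2 = 1 :> R by rewrite sqrrN expr1n.
move: (legendre_end p a1) (legendre_end p a2); rewrite expr1n.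
move: (legendre R p) => P P1 P2; rewrite !hornerD !(hornerZ m) P1 P2.
move: (qstar _ _ _ _ n) (qstar _ _ _ _ (ord_pred n)) ((-1) ^+ p) => r l o.
by move: (corrL p c) (corrR p c) => H K; rewrite -!mul_polyC !(polyCM, polyCB, polyCD); ring.
Qed.

(** * Explicit lifting operator *)

Section Lifting.
Hypotheses (N_gt1 : (1 < N)%N) (lifting : is_lifting p x lift).

Lemma liftingE e d (phi : field R N) : pw_poly p phi ->
  \sum_(n < N) jac x n * refint (lift e d n * phi n) = - d * avg phi e.
Proof.
move=> phip; rewrite -(lifting e d).2 //; apply: eq_bigr => n _.
rewrite -(Rintegral_phys _ (mesh (ltn_ord n))); apply: eq_Rintegral => y _.
by rewrite /phys comp_polyM hornerM.
Qed.

(** With at least two elements, the two sides of an edge lie in different elements, so a test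
    function can see one side only. *)
Lemma ordS_neq (e : 'I_N) : ordS e != e.
Proof.
rewrite -val_eqE /=; have := ltn_ord e; rewrite leq_eqVlt => /predU1P[eN|eN].
  by rewrite eN modnn; case: (val e) eN => //; lia.
by rewrite modn_small // gtn_eqF.
Qed.

Lemma avg_lift (e : 'I_N) d :
  avg (lift e d) e =
  - d * (p + 1)%N%:R ^+ 2 / 8 * ((jac x e)^-1 + (jac x (ordS e))^-1).
Proof.
have [lp _] := lifting e d.
(* At parameter 0 the form is the plain integral. The correction derivatives, extended by zero, are
   then test functions that extract the end values of the lifting; their own end value is (p + 1)^2
   / 2 in modulus. *)
have e0 : Defs.eta p 0 = 0 :> R by rewrite /Defs.eta !mul0r.
have t0 : 1 + Defs.eta p (0 : R) != 0 by rewrite e0 addr0 oner_neq0.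
have w0 : weight p (0 : R) = (2 * p + 1)%N%:R by rewrite /weight e0 addr0 divr1.
have [sL sR] := size_deriv_corr p_gt0 (0 : R).
have [_ eL eR _] := corr_end p_gt0 t0.
have jE n := lt0r_neq0 (jac_gt0 mesh n).
have R1 : jac x e * (lift e d e).[1] = - d * (p + 1)%N%:R ^+ 2 / 4.
  have := @liftingE e d (fun n => if n == e then (corrR p 0)^`() else 0).
  rewrite (bigD1 e) //= big1 ?addr0 ?eqxx => [|n /negPf ->]; last by rewrite mulr0 linear0 mulr0.
  have := esfr_form_corrR p_gt0 (lp e) t0; rewrite /esfr_form mul0r addr0 => ->.
  move=> ->; last by move=> n /=; case: ifP; rewrite ?size_poly0.
  rewrite /avg /trace_minus /trace_plus eqxx (negPf (ordS_neq e)) eR w0 horner0.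
  by field.
have R2 : jac x (ordS e) * (lift e d (ordS e)).[-1] = - d * (p + 1)%N%:R ^+ 2 / 4.
  have := @liftingE e d (fun n => if n == ordS e then (corrL p 0)^`() else 0).
  rewrite (bigD1 (ordS e)) //= big1 ?addr0 ?eqxx => [|n /negPf ->]; last by rewrite mulr0 linear0 mulr0.
  have := esfr_form_corrL p_gt0 (lp (ordS e)) t0; rewrite /esfr_form mul0r addr0 => ->.
  move=> H; rewrite -[LHS]opprK -mulrN H; last by move=> n /=; case: ifP; rewrite ?size_poly0.
  rewrite /avg /trace_minus /trace_plus eqxx eq_sym (negPf (ordS_neq e)) eL w0 horner0.
  by field.
rewrite /avg /trace_minus /trace_plus.
have -> : (lift e d e).[1] = - d * (p + 1)%N%:R ^+ 2 / 4 / jac x e by rewrite -R1 mulrC mulKf.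
have -> : (lift e d (ordS e)).[-1] = - d * (p + 1)%N%:R ^+ 2 / 4 / jac x (ordS e).
  by rewrite -R2 mulrC mulKf.
by move: (jac x e)^-1 (jac x (ordS e))^-1 => i j; field.
Qed.
End Lifting.
End Scheme.

(** * The value of the minimum and where it is attained *)

Lemma min_gL_gapE (R : realType) p : (0 < p)%N ->
  min_gL_gap R p = (p * p.+1)%N%:R / 2.
Proof.
move=> p0; have [k k0 wk] := weight_attained R p0.
have mk := gL_gap_min p0 k0.
have ek : gL_gap p k = (p * p.+1)%N%:R / 2 by apply/esym/eqP; rewrite mk.
have lb : lbound [set gL_gap p k | k in [set k : R | cminus R p < k]] ((p * p.+1)%N%:R / 2).
  by move=> _ [l l0 <-]; rewrite (gL_gap_min p0 l0).
apply/eqP; rewrite eq_le lb_le_inf ?andbT //; last by exists (gL_gap p k), k.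
by rewrite -ek; apply: ge_inf; [exists ((p * p.+1)%N%:R / 2) | exists k].
Qed.

Lemma attains_min_gL_gapE (R : realType) p (k : R) : (0 < p)%N ->
  attains_min_gL_gap p k <-> cminus R p < k /\ weight p k <= p%:R.
Proof.
move=> p0; rewrite /attains_min_gL_gap min_gL_gapE //.
split=> -[k0 h]; split=> //.
  by rewrite -(gL_gap_min p0 k0).2 h.
by apply/esym/eqP; rewrite (gL_gap_min p0 k0).2.
Qed.

(** * Sign of the sum of the edge terms *)

Section Stability.
Variables (R : realType) (p N : nat) (x : nat -> R).
Hypotheses (p_gt0 : (0 < p)%N) (N_gt1 : (1 < N)%N) (mesh : is_mesh N x).
Variables (s : R) (lift : 'I_N -> R -> field R N).
Hypothesis lifting : is_lifting p x lift.

Lemma Theta_sum_le0 k (u : field R N) :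
  cminus R p < k -> weight p k <= p%:R -> s_star R p < s ->
  \sum_(e < N) Theta p x k s lift u e <= 0.
Proof.
move=> k0 wk hs.
have t0 : 1 + Defs.eta p k != 0 by rewrite lt0r_neq0 // -eta_cminus.
have [eL1 eL2 eR1 eR2] := corr_end p_gt0 t0.
pose J := jump u; pose j n := (jac x n)^-1.
(* [A] and [G] are the values at 1 of the derivatives of [corrR p k] and [corrL p k]; [K] is the
   penalty, from [avg_lift]. [F] and [H] are the parts of an edge term scaled by the left and the
   right element; regrouped by element they form one quadratic form in its two jumps. *)
pose A := (p%:R ^+ 2 + weight p k) / 2; pose G : R := (-1) ^+ p / 2 * (p%:R - weight p k).
pose K := s * (p + 1)%N%:R ^+ 2 / 8.
pose F (n : 'I_N) := j n * (A / 4 * J n ^+ 2 - G / 4 * (J (ord_pred n) * J n) - K * J n ^+ 2).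
pose H (e : 'I_N) := j (ordS e) *
  (A / 4 * J e ^+ 2 - G / 4 * (J e * J (ordS e)) - K * J e ^+ 2).
have -> : \sum_(e < N) Theta p x k s lift u e = \sum_(n < N) (F n + H (ord_pred n)).
  rewrite sum_edges; apply: eq_bigr => e _.
  rewrite /Theta /qstar (avg_lift p_gt0 mesh N_gt1 lifting) /F /H /corrected_grad /avg /trace_plus /trace_minus.
  rewrite !(hornerZ, hornerD) eL1 eL2 eR1 eR2 !ordSK /J /K /G /A /j /jump /ustar /avg.
  rewrite /trace_plus /trace_minus /grad ?hornerZ !ord_predK.
  move: (jac x e)^-1 (jac x (ordS e))^-1 (weight p k) ((-1) ^+ p) => ie iS w o.
  move: (u (ord_pred e)).[1] (u e).[-1] (u e).[1] (u (ordS e)).[-1] (u (ordS e)).[1]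
    (u (ordS (ordS e))).[-1] => u0 u1 u2 u3 u4 u5.
  move: (u e)^`().[1] (u (ordS e))^`().[-1] => d1 d2.
  by field.
apply: sumr_le0 => n _; rewrite /F /H ord_predK -mulrDr.
rewrite pmulr_rle0 ?invr_gt0 ?jac_gt0 //.
move: (J n) (J (ord_pred n)) => a c.
(* Here A + |G| is p (p + 1) / 2, the minimal gap, so this diagonal dominance is the bound on
   [s]. *)
have AK : (A + (p%:R - weight p k) / 2) / 4 <= K.
  move: hs; rewrite /s_star min_gL_gapE // ltr_pdivrMr ?exprn_gt0 ?ltr0n ?addn1 // => /ltW.
  by rewrite /A /K natrM -[p.+1]addn1 !natrD => h; lra.
have GL : `|G| = (p%:R - weight p k) / 2.
  by rewrite /G !normrM normrX normrN1 expr1n mul1r ger0_norm ?ger0_norm ?subr_ge0 // mulrC.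
have Gac : - G * (c * a) <= `|G| * ((a ^+ 2 + c ^+ 2) / 2).
  apply: (le_trans (ler_norm _)); rewrite normrM normrN ler_wpM2l //.
  have := sqr_ge0 (`|a| - `|c|); rewrite normrM -(real_normK (num_real a)) -(real_normK (num_real c)) => h; lra.
have h := ler_wpM2r (addr_ge0 (sqr_ge0 a) (sqr_ge0 c)) AK.
by move: Gac; rewrite GL => Gac; lra.
Qed.
End Stability.

(** * Differentiation in time and conclusion *)

Lemma is_derive_esfr_form (R : realType) p (c t : R) (v : R -> {poly R}) (w : {poly R}) :
  (\forall tau \near t, (size (v tau) <= p.+1)%N) -> (size w <= p.+1)%N ->
  (forall r, -1 <= r <= 1 -> is_derive t (1 : R) (fun tau => (v tau).[r]) w.[r]) ->
  is_derive t (1 : R) (fun tau => esfr_form p c (v tau) (v tau)) (2 * esfr_form p c (v t) w).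
Proof.
move=> sv sw dv.
(* Time derivatives are known only at fixed points of [-1, 1]. Lagrange interpolation at these p + 1
   distinct nodes of ]0, 1] turns the form into a finite sum of products of point values. *)
pose y (i : nat) : R := i.+1%:R^-1.
have y_inj : injective y by move=> i j /invr_inj/eqP; rewrite eqr_nat eqSS => /eqP.
pose l i := (lagrange p.+1 y)`_i : {poly R}.
have lag (f : {poly R}) : (size f <= p.+1)%N -> f = \sum_(i < p.+1) f.[y i] *: l i.
  move=> sf; rewrite {1}(lagrange_gen (ltn0Sn p) y_inj sf); apply: eq_bigr => i _.
  by rewrite mul_polyC /l -tnth_nth.
have bil (f g : {poly R}) : (size f <= p.+1)%N -> (size g <= p.+1)%N ->
    esfr_form p c f g = \sum_(i < p.+1) \sum_(j < p.+1) f.[y i] * g.[y j] * esfr_form p c (l i) (l j).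
  move=> sf sg; rewrite {1}(lag f sf) esfr_formC linear_sum; apply: eq_bigr => i _ /=.
  rewrite linearZ /= esfr_formC {1}(lag g sg) linear_sum mulr_sumr.
  by apply: eq_bigr => j _ /=; rewrite linearZ /= mulrA.
have yb i : -1 <= y i <= 1.
  rewrite /y invf_le1 ?ltr0n // ler1n andbT.
  by rewrite (le_trans (y := 0)) ?invr_ge0 ?ler0n // oppr_le0.
pose h (i j : 'I_p.+1) (tau : R) : R :=
  (v tau).[y i] * (v tau).[y j] * esfr_form p c (l i) (l j).
pose dh (i j : 'I_p.+1) : R := ((v t).[y i] * w.[y j] + (v t).[y j] * w.[y i])
  * esfr_form p c (l i) (l j).
have hD i j : is_derive t (1 : R) (h i j) (dh i j).
  have di := dv _ (yb i); have dj := dv _ (yb j).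
  have -> : h i j = (fun tau => (v tau).[y i]) * (fun tau => (v tau).[y j])
    * cst (esfr_form p c (l i) (l j)) by [].
  apply: is_derive_eq.
  by rewrite scaler0 add0r /dh mulrC.
have -> : 2 * esfr_form p c (v t) w = \sum_(i < p.+1) \sum_(j < p.+1) dh i j.
  have svt := nbhs_singleton sv.
  rewrite mulr_natl mulr2n bil // [X in X + _]exchange_big -big_split /=.
  apply: eq_bigr => i _; rewrite -big_split /=; apply: eq_bigr => j _.
  by rewrite [esfr_form p c (l j) _]esfr_formC /dh; ring.
apply: (@near_eq_is_derive _ _ _ (\sum_(i < p.+1) \sum_(j < p.+1) h i j)).
  near=> tau; rewrite bil; [|near: tau; exact: sv..].
  by rewrite fct_sumE; apply: eq_bigr => i _; rewrite fct_sumE.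
Unshelve. all: by end_near. Qed.

(* The minimum defining s_star is attained.  The corrected gradient entering
   Theta is the one built with a parameter kappa0 attaining it; the stability of
   the scheme holds for all its parameters kappa and c. *)
Theorem corollary5p1 (R : realType) (p N : nat) (x : nat -> R)
    (b kappa c s T : R) (lift : 'I_N -> R -> field R N) (u : R -> field R N)
    (hp : (1 <= p)%N) (hN : (2 <= N)%N) (hx : is_mesh N x) (hb : 0 < b)
    (hkappa : cminus R p < kappa) (hc : cminus R p < c)
    (hlift : is_lifting p x lift)
    (hu : scheme_solution p x b kappa c s lift T u)
    (hs : s_star R p < s) :
  (exists kappa0 : R, attains_min_gL_gap p kappa0) /\
  forall t : R, 0 < t < T ->
    (forall kappa0 : R, attains_min_gL_gap p kappa0 ->
       \sum_(e < N) Theta p x kappa0 s lift (u t) e <= 0) /\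
    derivable (fun tau => energy_norm p x c (u tau) ^+ 2) t 1 /\
    derive1 (fun tau => energy_norm p x c (u tau) ^+ 2) t <= 0.
Proof.
have [k0 k0p wk0] := weight_attained R hp.
split; first by exists k0; apply/attains_min_gL_gapE.
move=> t tT; have [ut dut] := hu t tT; split.
  by move=> k /(attains_min_gL_gapE _ hp)[kp wk]; exact: Theta_sum_le0.
have nz k : cminus R p < k -> 1 + Defs.eta p k != 0.
  by rewrite eta_cminus // => /lt0r_neq0.
(* The degree bound is needed on a neighbourhood of [t], to rewrite the energy before
   differentiating it. *)
have nearT : \forall tau \near t, 0 < tau < T.
  have : t \in `]0, T[ by rewrite in_itv.
  by move/near_in_itvoo; apply: filterS => tau; rewrite in_itv.
pose rhs := scheme_rhs p x b k0 c s lift (u t).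
have rhsE : scheme_rhs p x b kappa c s lift (u t) = rhs.
  by apply: scheme_rhs_kappa; rewrite ?nz.
have dE : is_derive t (1 : R) (fun tau => energy_norm p x c (u tau) ^+ 2)
    (\sum_(n < N) jac x n * (2 * esfr_form p c (u t n) (rhs n))).
  apply: (@near_eq_is_derive _ _ _
    (\sum_(n < N) (fun tau => jac x n * esfr_form p c (u tau n) (u tau n)))).
    apply: filterS nearT => tau /hu[up _].
    by rewrite energy_normE // fct_sumE.
  apply: is_derive_sum => n; apply: is_deriveZ.
  apply: is_derive_esfr_form.
  - by apply: filterS nearT => tau /hu[up _].
  - rewrite (leq_trans (size_scale_leq _ _)) //.
    by apply: size_flux_rhs => //; exact: size_corrected_grad.
  - by move=> r r1; rewrite -rhsE; exact: dut.
split; first exact: ex_derive.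
rewrite derive1E derive_val.
have -> : \sum_(n < N) jac x n * (2 * esfr_form p c (u t n) (rhs n)) =
    2 * \sum_(n < N) jac x n * esfr_form p c (u t n) (rhs n).
  by rewrite mulr_sumr; apply: eq_bigr => n _; rewrite mulrCA.
(* The identity is used at the minimizing [k0]: its edge sum is nonpositive and the subtracted forms
   are nonnegative. *)
rewrite energy_identity ?nz // mulrCA pmulr_rle0 // pmulr_rle0 // subr_le0.
rewrite (le_trans (Theta_sum_le0 _ _ _ _ _ _ _ _)) // sumr_ge0 // => n _.
rewrite mulr_ge0 ?esfr_form_ge0 ?size_corrected_grad //.
by rewrite ltW // jac_gt0.
Qed.
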